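(* Let $\vec t_1,\vec t_2$ be tuples of terms of the same length, let $v_1,v_2$ be variables and let $\vec z$ be a tuple of variables of the same length as $\vec t_1$ and $\vec t_2$, where $v_1,v_2$ and the components of $\vec z$ are pairwise distinct and do not occur in $\vec t_1$ or $\vec t_2$. Then the inclusion atom $\vec t_1\subseteq\vec t_2$ is equivalent to the independence logic formula $$\phi := \forall v_1 \forall v_2 \forall\vec z \big((\vec z \neq \vec t_1 \wedge \vec z \neq \vec t_2) \vee (v_1 \neq v_2 \wedge \vec z \neq \vec t_2) \vee ((v_1 = v_2 \vee \vec z = \vec t_2) \wedge \vec z ~\bot~ v_1 v_2)\big),$$ that is, $M\models_X \vec t_1\subseteq\vec t_2 \Leftrightarrow M\models_X\phi$ for all models $M$ of the relevant signature and all teams $X$ over $M$ whose domain contains all variables occurring in $\vec t_1,\vec t_2$. In particular, inclusion atoms are expressible in terms of independence logic formulas.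
   Context: All first order models are assumed to have at least two elements in their domain; $\mathrm{Dom}(M)$ is the domain of $M$. An assignment over $M$ is a function from a set of variables to $\mathrm{Dom}(M)$; $s[m/x]$ is the assignment which sends $x$ to $m$ and otherwise agrees with $s$; $t\langle s\rangle$ is the value of the term $t$ in $M$ under $s$, and $\vec t\langle s\rangle$ is the corresponding tuple of values. A team $X$ over $M$ is a set of assignments over $M$ all having the same domain, called the domain of $X$. Equality of tuples $\vec a=\vec b$ abbreviates $\bigwedge_i a_i=b_i$, and $\vec a\neq\vec b$ abbreviates $\bigvee_i a_i\neq b_i$; $\forall \vec z$ abbreviates $\forall z_1\ldots\forall z_k$. $\vec z~\bot~v_1v_2$ is shorthand for the independence atom $\vec z~\bot_{\emptyset}~v_1v_2$ with empty conditioning tuple. The satisfaction relation $M\models_X\phi$ (lax team semantics), where the domain of $X$ contains the free variables of $\phi$, is: - for a first order literal $\phi$: $M\models_s\phi$ (Tarski) for all $s\in X$; - $M\models_X \vec t_1\subseteq\vec t_2$ iff for every $s\in X$ there is $s'\in X$ with $\vec t_1\langle s\rangle=\vec t_2\langle s'\rangle$; - $M\models_X \vec t_2 ~\bot_{\vec t_1}~ \vec t_3$ iff for all $s,s'\in X$ with $\vec t_1\langle s\rangle=\vec t_1\langle s'\rangle$ there is $s''\in X$ with $\vec t_1\langle s''\rangle\vec t_2\langle s''\rangle=\vec t_1\langle s\rangle\vec t_2\langle s\rangle$ and $\vec t_1\langle s''\rangle\vec t_3\langle s''\rangle=\vec t_1\langle s'\rangle\vec t_3\langle s'\rangle$; -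 $M\models_X\psi\vee\theta$ iff $X=Y\cup Z$ for some teams $Y,Z$ with $M\models_Y\psi$ and $M\models_Z\theta$; - $M\models_X\psi\wedge\theta$ iff $M\models_X\psi$ and $M\models_X\theta$; - $M\models_X\exists x\psi$ iff there is $H:X\to\mathcal P(\mathrm{Dom}(M))\setminus\{\emptyset\}$ with $M\models_{X[H/x]}\psi$, where $X[H/x]=\{s[m/x]:s\in X,\ m\in H(s)\}$; - $M\models_X\forall x\psi$ iff $M\models_{X[M/x]}\psi$, where $X[M/x]=\{s[m/x]:s\in X,\ m\in\mathrm{Dom}(M)\}$. Independence logic is the logic whose formulas (in negation normal form) are built from first order literals and independence atoms with $\wedge,\vee,\exists,\forall$. *)

(* Defs.v *)
From HB Require Import structures.
From mathcomp Require Import all_boot.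
From mathcomp Require Import boolp classical_sets.
Set Implicit Arguments.
Unset Strict Implicit.
Unset Printing Implicit Defensive.
Local Open Scope classical_set_scope.

Record signature := Signature {
  fsym : Type;
  far : fsym -> nat;
  rsym : Type;
  rar : rsym -> nat }.

(* Variables are natural numbers. *)
Inductive term (S : signature) :=
| TVar of nat
| TApp (f : fsym S) of ('I_(far f) -> term S).
Arguments TVar {S}.

Inductive literal (S : signature) :=
| LEq of term S & term S
| LNeq of term S & term S
| LRel (r : rsym S) of ('I_(rar r) -> term S)
| LNRel (r : rsym S) of ('I_(rar r) -> term S).

(* [FIndep t1 t2 t3] is the atom t2 _||_{t1} t3: the conditioning tuple comes
   first. *)
Inductive formula (S : signature) :=
| FLit of literal S
| FIncl (k : nat) of k.-tuple (term S) & k.-tuple (term S)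
| FIndep of seq (term S) & seq (term S) & seq (term S)
| FAnd of formula S & formula S
| FOr of formula S & formula S
| FEx of nat & formula S
| FAll of nat & formula S.

Fixpoint tvars S (t : term S) : seq nat :=
  match t with
  | TVar x => [:: x]
  | TApp f args => flatten [seq tvars (args i) | i <- enum 'I_(far f)]
  end.

Definition tsvars S (ts : seq (term S)) : seq nat :=
  flatten [seq tvars t | t <- ts].

Definition lvars S (l : literal S) : seq nat :=
  match l with
  | LEq t u | LNeq t u => tvars t ++ tvars u
  | LRel r args | LNRel r args =>
      flatten [seq tvars (args i) | i <- enum 'I_(rar r)]
  end.

Fixpoint fvars S (p : formula S) : seq nat :=
  match p with
  | FLit l => lvars l
  | FIncl _ t1 t2 => tsvars t1 ++ tsvars t2
  | FIndep t1 t2 t3 => tsvars t1 ++ tsvars t2 ++ tsvars t3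
  | FAnd p q | FOr p q => fvars p ++ fvars q
  | FEx x p | FAll x p => [seq y <- fvars p | y != x]
  end.

Fixpoint is_independence_logic S (p : formula S) : bool :=
  match p with
  | FLit _ | FIndep _ _ _ => true
  | FIncl _ _ _ => false
  | FAnd p q | FOr p q => is_independence_logic p && is_independence_logic q
  | FEx _ p | FAll _ p => is_independence_logic p
  end.

Record model (S : signature) := Model {
  Dom : Type;
  fint : forall f : fsym S, (far f).-tuple Dom -> Dom;
  rint : forall r : rsym S, (rar r).-tuple Dom -> Prop;
  two_elements : exists a b : Dom, a <> b }.

(* An assignment is a partial function; [None] means outside its domain. *)
Definition assignment (A : Type) := nat -> option A.

Definition asg_dom A (s : assignment A) : set nat := [set x | isSome (s x)].

Definition asg_upd A (s : assignment A) (x : nat) (m : A) : assignment A :=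
  fun y => if y == x then Some m else s y.

(* The empty set of assignments is a team with any domain. *)
Definition is_team A (D : set nat) (X : set (assignment A)) :=
  forall s, X s -> asg_dom s = D.

(* [pmap] drops undefined entries, so the length test performed by [insub]
   succeeds exactly when every entry is defined. *)
Definition otuple A n (f : 'I_n -> option A) : option (n.-tuple A) :=
  insub (pmap f (enum 'I_n)).

Fixpoint tval S (M : model S) (s : assignment (Dom M)) (t : term S)
    : option (Dom M) :=
  match t with
  | TVar x => s x
  | TApp f args => omap (@fint S M f) (otuple (fun i => tval s (args i)))
  end.

Definition tsval S (M : model S) (s : assignment (Dom M)) (ts : seq (term S))
    : seq (option (Dom M)) := [seq tval s t | t <- ts].

Definition lsat S (M : model S) (s : assignment (Dom M)) (l : literal S)
    : Prop :=
  match l with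
  | LEq t u => tval s t = tval s u
  | LNeq t u => tval s t <> tval s u
  | LRel r args =>
      if otuple (fun i => tval s (args i)) is Some a then rint a else False
  | LNRel r args =>
      if otuple (fun i => tval s (args i)) is Some a then ~ rint a else False
  end.

Definition team_supp A (X : set (assignment A)) (H : assignment A -> set A)
    (x : nat) : set (assignment A) :=
  [set s' | exists2 s, X s & exists2 m, H s m & s' = asg_upd s x m].

Definition team_dup A (X : set (assignment A)) (x : nat)
    : set (assignment A) :=
  [set s' | exists2 s, X s & exists m : A, s' = asg_upd s x m].

(* Lax team semantics, meaningful when X is a team whose domain contains the
   free variables of the formula.  In the [FOr] case, Y and Z are teams with
   the domain of X because they are subsets of X.  In the [FEx] case, only the
   values of H on X matter. *)
Fixpoint sat S (M : model S) (X : set (assignment (Dom M))) (p : formula S)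
    : Prop :=
  match p with
  | FLit l => forall s, X s -> lsat s l
  | FIncl _ t1 t2 =>
      forall s, X s -> exists2 s', X s' & tsval s t1 = tsval s' t2
  | FIndep t1 t2 t3 =>
      forall s s', X s -> X s' -> tsval s t1 = tsval s' t1 ->
      exists s'', [/\ X s'',
        tsval s'' (t1 ++ t2) = tsval s (t1 ++ t2) &
        tsval s'' (t1 ++ t3) = tsval s' (t1 ++ t3)]
  | FAnd p q => sat X p /\ sat X q
  | FOr p q => exists Y Z, [/\ X = Y `|` Z, sat Y p & sat Z q]
  | FEx x p => exists2 H : assignment (Dom M) -> set (Dom M),
      (forall s, X s -> H s !=set0) & sat (team_supp X H x) p
  | FAll x p => sat (team_dup X x) p
  end.

(* The empty conjunction and disjunction, which arise only for tuples of
   length 0, are rendered by the sentences "forall x, x = x" and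
   "forall x, x <> x". *)
Fixpoint big_and S (ps : seq (formula S)) : formula S :=
  match ps with
  | [::] => FAll 0 (FLit (LEq (TVar 0) (TVar 0)))
  | [:: p] => p
  | p :: ps' => FAnd p (big_and ps')
  end.

Fixpoint big_or S (ps : seq (formula S)) : formula S :=
  match ps with
  | [::] => FAll 0 (FLit (LNeq (TVar 0) (TVar 0)))
  | [:: p] => p
  | p :: ps' => FOr p (big_or ps')
  end.

Definition tuple_eq S k (t u : k.-tuple (term S)) : formula S :=
  big_and [seq FLit (LEq p.1 p.2) | p <- zip t u].

Definition tuple_neq S k (t u : k.-tuple (term S)) : formula S :=
  big_or [seq FLit (LNeq p.1 p.2) | p <- zip t u].

Definition forall_vars S (zs : seq nat) (p : formula S) : formula S :=
  foldr (@FAll S) p zs.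

Definition inclusion_formula S k (t1 t2 : k.-tuple (term S)) (v1 v2 : nat)
    (z : k.-tuple nat) : formula S :=
  let zt : k.-tuple (term S) := [tuple of map TVar z] in
  let x1 : term S := TVar v1 in
  let x2 : term S := TVar v2 in
  FAll v1 (FAll v2 (forall_vars z
    (FOr (FOr
      (FAnd (tuple_neq zt t1) (tuple_neq zt t2))
      (FAnd (FLit (LNeq x1 x2)) (tuple_neq zt t2)))
      (FAnd (FOr (FLit (LEq x1 x2)) (tuple_eq zt t2))
            (FIndep [::] zt [:: x1; x2]))))).

(* Satisfaction agrees on all models and all teams whose domain contains V. *)
Definition equivalent_over S (V : seq nat) (p q : formula S) : Prop :=
  forall (M : model S) (D : set nat) (X : set (assignment (Dom M))),
    is_team D X -> (forall x, x \in V -> D x) -> (sat X p <-> sat X q).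

(* Main.v *)
Require Import Defs.
From mathcomp Require Import all_boot.
From mathcomp Require Import boolp classical_sets.
(* Makes [fsym] and [tval] denote those of [Defs] rather than those of MathComp. *)
Import Defs.
Set Implicit Arguments.
Unset Strict Implicit.
Unset Printing Implicit Defensive.

(** The innermost disjunction splits the team obtained by duplicating X along
    v1, v2, z. Its first two disjuncts are first order, so an assignment is
    forced into the third part W exactly when z = t2, or z = t1 and v1 = v2.
    If t1 is included in t2, every value of z in W is t2(s) for some s in X, and
    is therefore compatible with all values of v1 and v2: z and v1 v2 are
    independent in W. Conversely, let s in X and a <> b. W contains an
    assignment with z = t1(s), v1 = v2 = a, and one with z = t2(s), v1 = a,
    v2 = b; independence gives one with z = t1(s), v1 = a, v2 = b, where
    v1 <> v2 forces z = t2, so t1(s) is a value of t2 on X. *)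

Local Open Scope classical_set_scope.

(** * Definedness and locality of term values *)

Lemma otuple_ext A n (f g : 'I_n -> option A) : f =1 g -> otuple f = otuple g.
Proof. by move=> fg; rewrite /otuple (eq_pmap fg). Qed.

Lemma otuple_isSome A n (f : 'I_n -> option A) :
  (forall i, isSome (f i)) -> isSome (otuple f).
Proof.
move=> fS; rewrite /otuple; case: insubP => //= /negP; case.
rewrite size_pmap (eq_count (a2 := predT)) ?count_predT ?size_enum_ord //.
Qed.

Lemma all_isSome A (os : seq (option A)) :
  all isSome os -> exists2 cs, size cs = size os & os = map Some cs.
Proof.
elim: os => [|[c|] os IH] //=; first by exists [::].
by move=> /IH [cs <- ->]; exists (c :: cs).
Qed.

Section Terms.
Variables (S : signature) (M : model S).
Implicit Types (s : assignment (Dom M)) (ts : seq (term S)).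

Lemma mem_tvars_arg (f : fsym S) (args : 'I_(far f) -> term S) i x :
  x \in tvars (args i) -> x \in tvars (TApp args).
Proof.
by move=> xi; apply/flatten_mapP; exists i => //; rewrite mem_enum.
Qed.

Lemma tval_ext s s' (t : term S) :
  {in tvars t, s =1 s'} -> tval s t = tval s' t.
Proof.
elim: t => [x|f args IH] /= ss'; first by rewrite ss' ?mem_head.
congr omap; apply: otuple_ext => i; apply: IH => x xi.
exact/ss'/mem_tvars_arg/xi.
Qed.

Lemma tval_isSome s (t : term S) :
  (forall x, x \in tvars t -> isSome (s x)) -> isSome (tval s t).
Proof.
elim: t => [x|f args IH] /= sS; first by apply: sS; rewrite mem_head.
have : isSome (otuple (fun i => tval s (args i))).
  by apply: otuple_isSome => i; apply: IH => x xi; apply/sS/mem_tvars_arg/xi.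
by case: otuple.
Qed.

Lemma tsval_ext s s' ts : {in tsvars ts, s =1 s'} -> tsval s ts = tsval s' ts.
Proof.
elim: ts => //= t ts IH ss'; congr cons.
  by apply: tval_ext => x xt; apply: ss'; rewrite /tsvars /= mem_cat xt.
by apply: IH => x xt; apply: ss'; rewrite /tsvars /= mem_cat [X in _ || X]xt orbT.
Qed.

Lemma tsval_isSome s ts :
  (forall x, x \in tsvars ts -> isSome (s x)) -> all isSome (tsval s ts).
Proof.
elim: ts => //= t ts IH sS; apply/andP; split.
  by apply: tval_isSome => x xt; apply: sS; rewrite /tsvars /= mem_cat xt.
by apply: IH => x xts; apply: sS; rewrite /tsvars /= mem_cat [X in _ || X]xts orbT.
Qed.

Lemma tsval_TVar s (zs : seq nat) : tsval s (map TVar zs) = map s zs.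
Proof. by rewrite /tsval -map_comp. Qed.

End Terms.

(** * Flatness of first order formulas *)

Section Flat.
Variables (S : signature) (M : model S).
Implicit Types (X : set (assignment (Dom M))) (p q : formula S).

(** Flatness in team semantics. Carrying the pointwise truth condition [P] along lets the Tarskian
    meaning of a compound formula be read off from its parts. *)
Definition flat p (P : assignment (Dom M) -> Prop) :=
  forall X, sat X p <-> (forall s, X s -> P s).

Lemma flat_lit (l : literal S) : flat (FLit l) (fun s => lsat s l).
Proof. by []. Qed.

Lemma flat_and p q P Q :
  flat p P -> flat q Q -> flat (FAnd p q) (fun s => P s /\ Q s).
Proof.
move=> fp fq X; rewrite /= fp fq; split => [[HP HQ] s Xs|H].
  by split; [exact: HP|exact: HQ].
by split=> s /H [].
Qed.

Lemma flat_or p q P Q :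
  flat p P -> flat q Q -> flat (FOr p q) (fun s => P s \/ Q s).
Proof.
move=> fp fq X; split => [[Y [Z [-> /fp HY /fq HZ]]] s [/HY|/HZ]|H];
  [by left|by right|].
exists (X `&` [set s | P s]), (X `&` [set s | Q s]); split.
- by rewrite -setIUr; apply/esym/setIidPl => s /H.
- by apply/fp => s [].
- by apply/fq => s [].
Qed.

Lemma sat_big_and_cons X p ps :
  sat X (big_and (p :: ps)) <-> sat X p /\ sat X (big_and ps).
Proof. by case: ps => //=; split => [|[]]. Qed.

Lemma sat_big_or_nil X : sat X (big_or [::]) <-> X = set0.
Proof.
split=> [H|->]; last by move=> s [].
(* Only a nonempty domain matters here: any [s] in [X] then survives duplication, where it would
   have to satisfy [x <> x]. *)
have [a _] := two_elements M.
rewrite -subset0 => s Xs.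
by apply: (H (asg_upd s 0 a)) => //; exists s => //; exists a.
Qed.

(** For a single disjunct, the added empty disjunction can take the empty team and nothing else. *)
Lemma sat_big_or_cons X p ps :
  sat X (big_or (p :: ps)) <-> sat X (FOr p (big_or ps)).
Proof.
case: ps => //; split => [Xp|[Y [Z [-> Yp /sat_big_or_nil->]]]].
  by exists X, set0; split; rewrite ?setU0 //; apply/sat_big_or_nil.
by rewrite setU0.
Qed.

Lemma flat_tuple_eq k (t u : k.-tuple (term S)) :
  flat (tuple_eq t u) (fun s => tsval s t = tsval s u).
Proof.
move=> X; rewrite /tuple_eq; case: t u => [t /= /eqP <-] [u /= /eqP szu].
elim: t u szu => [|x t IH] [|y u] // [szu].
rewrite [zip _ _]/= [map _ _]/= sat_big_and_cons (IH _ szu) /=.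
split=> [[Hx Ht] s Xs|H]; first by rewrite Hx ?Ht.
by split=> s /H [].
Qed.

Lemma flat_tuple_neq k (t u : k.-tuple (term S)) :
  flat (tuple_neq t u) (fun s => tsval s t <> tsval s u).
Proof.
move=> X; rewrite /tuple_neq; case: t u => [t /= /eqP <-] [u /= /eqP szu].
(* The induction runs over all teams, since a disjunction passes to subteams. *)
elim: t u szu X => [|x t IH] [|y u] // => [_|[szu]] X.
  rewrite sat_big_or_nil; split=> [-> //|H].
  by rewrite -subset0 => s /H.
rewrite [zip _ _]/= [map _ _]/= sat_big_or_cons (flat_or (flat_lit _) (IH _ szu)) /=.
split=> H s /H; first by move=> [] neq [].
move=> neq; case: (pselect (tval s x = tval s y)) => [exy|]; last by left.
by right=> etu; apply: neq; congr cons.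
Qed.

(** By flatness, the first disjunct may as well take every assignment of [X] satisfying [P]; lax
    disjunction allows the two parts to overlap. Only the choice of [W] remains. *)
Lemma sat_or_flat_and X p q r P Q :
  flat p P -> flat q Q ->
  sat X (FOr p (FAnd q r)) <->
  exists W, [/\ W `<=` X, (forall s, X s -> P s \/ W s),
    (forall s, W s -> Q s) & sat W r].
Proof.
move=> fp fq; split=> [[Y [W [-> /fp HY [/fq HW Wr]]]]|[W [WX cov WQ Wr]]].
  by exists W; split=> // s [/HY|]; [left|right].
exists (X `&` [set s | P s]), W; split.
- rewrite eqEsubset; split=> s; last by case=> [[]|/WX].
  by move=> Xs; case: (cov s Xs); [left|right].
- by apply/fp => s [].
- by split=> //; apply/fq.
Qed.

End Flat.

(** * Blocks of universal quantifiers *)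

Section ForallVars.
Variables (S : signature) (M : model S).
Implicit Types (X : set (assignment (Dom M))) (s : assignment (Dom M)).

(* [xs] may contain repetitions: only the last quantification over a variable
   matters, and the description below does not see it. *)
Definition team_dups X (xs : seq nat) : set (assignment (Dom M)) :=
  [set s' | all (fun x => isSome (s' x)) xs /\
            exists2 s, X s & forall x, x \notin xs -> s' x = s x].

Lemma team_dups_nil X : team_dups X [::] = X.
Proof.
rewrite eqEsubset; split=> [s' [_ [s Xs e]]|s Xs]; last by split=> //; exists s.
by have -> : s' = s by apply/funext => x; apply: e.
Qed.

Lemma team_dups_cons X x xs :
  team_dups (team_dup X x) xs = team_dups X (x :: xs).
Proof.
rewrite eqEsubset; split=> s' [].
  move=> def [_ [s Xs [m ->]] e]; split; last first.
    exists s => // y; rewrite inE negb_or => /andP [/negbTE yx yxs].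
    by rewrite e // /asg_upd yx.
  rewrite /= def andbT; have [/(allP def)//|/e ->] := boolP (x \in xs).
  by rewrite /asg_upd eqxx.
move=> /= /andP [dx def] [s Xs e]; split=> //.
case es: (s' x) dx => [m|] // _.
(* The intermediate assignment gives [x] its final value already, so it is correct whether or not
   [x] is quantified again in [xs]. *)
exists (asg_upd s x m); first by exists s => //; exists m.
move=> y yxs; rewrite /asg_upd; case: eqP => [->//|/eqP yx].
by rewrite e // inE negb_or yx.
Qed.

Lemma sat_forall_vars X xs (p : formula S) :
  sat X (forall_vars xs p) <-> sat (team_dups X xs) p.
Proof.
elim: xs X => [|x xs IH] X; first by rewrite team_dups_nil.
by rewrite /= IH team_dups_cons.
Qed.

Lemma team_dups_ex X s xs (cs : seq (Dom M)) :
  uniq xs -> size cs = size xs -> X s ->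
  exists s', [/\ team_dups X xs s', map s' xs = map Some cs &
    forall x, x \notin xs -> s' x = s x].
Proof.
move=> + szc Xs; move: xs cs szc.
(* Membership in the duplicated team follows from the values on and off [xs], so the induction can
   ignore the team. *)
suff H xs cs : size cs = size xs -> uniq xs ->
    exists s', map s' xs = map Some cs /\ forall x, x \notin xs -> s' x = s x.
  move=> xs cs szc /(H _ _ szc) [s' [es' e]]; exists s'; split=> //.
  split; last by exists s.
  by rewrite -(all_map s' isSome) es' all_map all_predT.
elim: xs cs => [|x xs IH] [|c cs] // => [_|[szc]]; first by exists s.
case/andP=> xxs /(IH _ szc) [s' [es' e]]; exists (asg_upd s' x c); split.
  rewrite /= {1}/asg_upd eqxx -es'; congr cons; apply/eq_in_map => y yxs.
  by rewrite /asg_upd; case: eqP yxs xxs => // -> ->.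
move=> y; rewrite inE negb_or => /andP [/negbTE yx yxs].
by rewrite /asg_upd yx e.
Qed.

End ForallVars.

(** * Equivalence of the inclusion atom and the formula *)

Lemma sat_inclusion_formula S k (t1 t2 : k.-tuple (term S)) v1 v2
    (z : k.-tuple nat) (M : model S) (X : set (assignment (Dom M))) :
  sat X (inclusion_formula t1 t2 v1 v2 z) <->
  exists W, let X' := team_dups X [:: v1, v2 & z] in
  [/\ W `<=` X',
    (forall s, X' s -> [\/ map s z <> tsval s t1 /\ map s z <> tsval s t2,
                          s v1 <> s v2 /\ map s z <> tsval s t2 | W s]),
    (forall s, W s -> s v1 = s v2 \/ map s z = tsval s t2) &
    (forall s s', W s -> W s' -> exists s'',
      [/\ W s'', map s'' z = map s z & s'' v1 = s' v1 /\ s'' v2 = s' v2])].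
Proof.
(* The two outer quantifiers and the block over [z] are, by conversion, a single block. *)
rewrite (sat_forall_vars X [:: v1, v2 & z]).
rewrite (sat_or_flat_and _ _ (flat_or
  (flat_and (flat_tuple_neq _ _) (flat_tuple_neq _ _))
  (flat_and (flat_lit _) (flat_tuple_neq _ _)))
  (flat_or (flat_lit _) (flat_tuple_eq _ _))).
have tsvalz s : tsval s [tuple of map TVar z] = map s z by rewrite tsval_TVar.
set X' := team_dups _ _.
have indepE W : sat W (FIndep [::] [tuple of map TVar z] [:: TVar v1; TVar v2])
    <-> forall s s' : assignment (Dom M), W s -> W s' -> exists s'',
      [/\ W s'', map s'' z = map s z & s'' v1 = s' v1 /\ s'' v2 = s' v2].
  split=> H s s' Ws Ws'.
    have [s'' [Ws'' +]] := H s s' Ws Ws' erefl.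
    by rewrite !tsvalz => ? [] ? ?; exists s''.
  have [s'' [Ws'' ez [e1 e2]]] := H s s' Ws Ws'.
  by exists s''; rewrite !tsvalz /= e1 e2.
split=> -[W [WX cov WQ]] => [/indepE|] HW; exists W; split=> //.
- by move=> s /cov; rewrite tsvalz => -[[|]|]; by constructor.
- by move=> s /WQ; rewrite tsvalz.
- by move=> s /cov; rewrite tsvalz => -[|?|?]; [left; left|left; right|right].
- by move=> s /WQ; rewrite tsvalz.
exact/indepE.
Qed.

Lemma inclusion_formulaP S k (t1 t2 : k.-tuple (term S)) v1 v2
    (z : k.-tuple nat) :
  uniq [:: v1, v2 & z] ->
  (forall x, x \in [:: v1, v2 & z] -> x \notin tsvars t1 ++ tsvars t2) ->
  equivalent_over (tsvars t1 ++ tsvars t2)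
    (FIncl t1 t2) (inclusion_formula t1 t2 v1 v2 z).
Proof.
set vs := [:: v1, v2 & z] => vs_uniq fresh M D X Xteam DX.
rewrite sat_inclusion_formula; set X' := team_dups X vs.
have szz : size z = k by rewrite size_tuple.
(* Values of [t1] and [t2] on [X] are genuine elements, hence can be assigned to [z]. *)
have X_defined s (t : k.-tuple (term S)) : X s ->
    {subset tsvars t <= tsvars t1 ++ tsvars t2} ->
    exists2 cs, size cs = k & tsval s t = map Some cs.
  move=> Xs tD; have [|cs szcs e] := @all_isSome _ (tsval s t).
    by apply: tsval_isSome => x /tD/DX; rewrite -(Xteam s Xs).
  by exists cs; rewrite // szcs size_map size_tuple.
have sub1 : {subset tsvars t1 <= tsvars t1 ++ tsvars t2}.
  by move=> x; rewrite mem_cat => ->.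
have sub2 : {subset tsvars t2 <= tsvars t1 ++ tsvars t2}.
  by move=> x; rewrite mem_cat orbC => ->.
have tsval_off s s' (t : k.-tuple (term S)) :
    {subset tsvars t <= tsvars t1 ++ tsvars t2} ->
    (forall x, x \notin vs -> s' x = s x) ->
    tsval (M := M) s' t = tsval s t.
  by move=> tD e; apply: tsval_ext => x /tD xt; apply/e/(contraL (fresh x)).
split=> [incl|[W [WX' cov WQ indep]] s Xs].
  (* These are exactly the assignments failing both first order disjuncts. *)
  exists (X' `&` [set s | map s z = tsval s t2 \/
                          map s z = tsval s t1 /\ s v1 = s v2]); split.
  - by move=> s [].
  - move=> s X's.
    case: (pselect (map s z = tsval s t2)) => [e2|n2].
      by constructor 3; split=> //; left.
    case: (pselect (map s z = tsval s t1)) => [e1|n1]; last by constructor 1.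
    case: (pselect (s v1 = s v2)) => [e|n]; last by constructor 2.
    by constructor 3; split=> //; right.
  - by move=> s [_ [|[]]]; [right|left].
  move=> s s' [[sdef [r Xr rs]] sz] [[s'def _] _].
  (* [s] lies over [r] in [X]: if [z] equals [t2] at [s], then [r] itself serves; otherwise [z]
     equals [t1] and the inclusion atom provides [s0]. *)
  have [s0 Xs0 es0] : exists2 s0, X s0 & map s z = tsval s0 t2.
    case: sz => [->|[-> _]]; first by exists r => //; exact: tsval_off.
    by rewrite (tsval_off r) //; exact: incl.
  have [cs szcs ecs] := X_defined s0 t2 Xs0 sub2.
  case/and3P: s'def; case e1: (s' v1) => [a|] // _; case e2: (s' v2) => [b|] // _ _.
  (* Building over [s0] makes [z] equal to [t2], so the assignment stays in [W] whatever [v1] and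
     [v2] are, in particular with their values from [s']. *)
  have [|s'' [X's'' [e1'' e2'' ez''] off]] :=
    team_dups_ex (cs := [:: a, b & cs]) vs_uniq _ Xs0.
    by rewrite /= szcs szz.
  exists s''; rewrite ez'' es0 ecs; split=> //; split=> //.
  by left; rewrite [LHS]ez'' -ecs -(tsval_off s0 s'').
(* Distinct elements allow [v1] and [v2] to disagree in [r']. *)
have [a [b ab]] := two_elements M.
have [c szc ec] := X_defined s t1 Xs sub1.
have [d szd ed] := X_defined s t2 Xs sub2.
have [|r [X'r [r1 r2 rz] roff]] :=
  team_dups_ex (cs := [:: a, a & c]) vs_uniq _ Xs.
  by rewrite /= szc szz.
have [|r' [X'r' [r'1 r'2 r'z] r'off]] :=
  team_dups_ex (cs := [:: a, b & d]) vs_uniq _ Xs.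
  by rewrite /= szd szz.
have Wr : W r.
  case: (cov r X'r) => // -[]; last by rewrite r1 r2.
  by rewrite [map r z]rz -ec (tsval_off s).
have Wr' : W r'.
  by case: (cov r' X'r') => // -[_]; rewrite [map r' z]r'z -ed (tsval_off s).
have [s'' [Ws'' ez [e1 e2]]] := indep r r' Wr Wr'.
(* [s''] lies over some [s0] in [X], and [t2] has the same value at both because it contains no
   quantified variable. *)
have [_ [s0 Xs0 s''off]] := WX' s'' Ws''.
exists s0 => //; rewrite -(tsval_off s0 s'') // ec -[RHS]/(tsval s'' t2).
case: (WQ s'' Ws'') => [|<-]; first by rewrite e1 e2 r'1 r'2 => -[].
by rewrite ez [RHS]rz.
Qed.

(** * Membership in independence logic and free variables *)

Section Syntax.
Variable S : signature.
Implicit Types (p : formula S) (ps : seq (formula S)).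

Lemma is_independence_logic_big_and ps :
  all (@is_independence_logic S) ps -> is_independence_logic (big_and ps).
Proof. by elim: ps => [|p [|q ps] IH] //= /andP [-> // /IH]. Qed.

Lemma is_independence_logic_big_or ps :
  all (@is_independence_logic S) ps -> is_independence_logic (big_or ps).
Proof. by elim: ps => [|p [|q ps] IH] //= /andP [-> // /IH]. Qed.

Lemma is_independence_logic_forall_vars xs p :
  is_independence_logic (forall_vars xs p) = is_independence_logic p.
Proof. by elim: xs. Qed.

Lemma is_independence_logic_inclusion_formula k (t1 t2 : k.-tuple (term S))
    v1 v2 (z : k.-tuple nat) :
  is_independence_logic (inclusion_formula t1 t2 v1 v2 z).
Proof.
rewrite (is_independence_logic_forall_vars [:: v1, v2 & z]) /= !andbT.
have neq (t u : k.-tuple (term S)) : is_independence_logic (tuple_neq t u).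
  by apply: is_independence_logic_big_or; rewrite all_map; apply/allT.
rewrite !neq /=.
by apply: is_independence_logic_big_and; rewrite all_map; apply/allT.
Qed.

Lemma fvars_big_and ps : {subset fvars (big_and ps) <= flatten (map (@fvars S) ps)}.
Proof.
elim: ps => [|p [|q ps] IH] x //=; first by rewrite cats0.
by rewrite !mem_cat => /orP [->//|/IH]; rewrite /= mem_cat => ->; rewrite orbT.
Qed.

Lemma fvars_big_or ps : {subset fvars (big_or ps) <= flatten (map (@fvars S) ps)}.
Proof.
elim: ps => [|p [|q ps] IH] x //=; first by rewrite cats0.
by rewrite !mem_cat => /orP [->//|/IH]; rewrite /= mem_cat => ->; rewrite orbT.
Qed.

Lemma mem_fvars_forall_vars xs p x :
  (x \in fvars (forall_vars xs p)) = (x \notin xs) && (x \in fvars p).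
Proof.
by elim: xs => //= y xs IH; rewrite mem_filter IH inE negb_or andbA.
Qed.

Lemma fvars_tuple_eq k (t u : k.-tuple (term S)) :
  {subset fvars (tuple_eq t u) <= tsvars t ++ tsvars u}.
Proof.
move=> x /fvars_big_and; case: t u => [t _] [u _] /=.
elim: t u => [|a t IH] [|b u] //=.
rewrite /tsvars /= !mem_cat => /orP [/orP [->|->]|/IH]; rewrite ?orbT //.
by rewrite mem_cat => /orP [->|->]; rewrite ?orbT.
Qed.

Lemma fvars_tuple_neq k (t u : k.-tuple (term S)) :
  {subset fvars (tuple_neq t u) <= tsvars t ++ tsvars u}.
Proof.
move=> x /fvars_big_or; case: t u => [t _] [u _] /=.
elim: t u => [|a t IH] [|b u] //=.
rewrite /tsvars /= !mem_cat => /orP [/orP [->|->]|/IH]; rewrite ?orbT //.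
by rewrite mem_cat => /orP [->|->]; rewrite ?orbT.
Qed.

Lemma tsvars_TVar (zs : seq nat) : tsvars (map (@TVar S) zs) = zs.
Proof. by elim: zs => // x zs IH; rewrite /tsvars /= [flatten _]IH. Qed.

(** The quantifier prefix binds [v1], [v2] and [z], the only variables added to those of the
    terms. *)
Lemma fvars_inclusion_formula k (t1 t2 : k.-tuple (term S)) v1 v2
    (z : k.-tuple nat) :
  {subset fvars (inclusion_formula t1 t2 v1 v2 z) <= tsvars t1 ++ tsvars t2}.
Proof.
move=> x; rewrite (mem_fvars_forall_vars [:: v1, v2 & z]) => /andP [].
rewrite !inE !negb_or => /and3P [/negbTE n1 /negbTE n2 /negbTE nz].
have zE : tsvars [tuple of map (@TVar S) z] = z := tsvars_TVar z.
have eqE (t : k.-tuple (term S)) :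
    x \in fvars (tuple_eq [tuple of map TVar z] t) -> x \in tsvars t.
  by move/fvars_tuple_eq; rewrite mem_cat zE nz.
have neqE (t : k.-tuple (term S)) :
    x \in fvars (tuple_neq [tuple of map TVar z] t) -> x \in tsvars t.
  by move/fvars_tuple_neq; rewrite mem_cat zE nz.
rewrite /= tsvars_TVar -[tsvars [:: _; _]]/[:: v1; v2].
rewrite !(mem_cat, inE) n1 n2 nz !orbF /=.
by move=> /orP [/orP [/orP [/neqE|/neqE]|/neqE]|/eqE] ->; rewrite ?orbT.
Qed.

End Syntax.

Theorem theorem4p13 (S : signature) (k : nat) (t1 t2 : k.-tuple (term S)) :
  (forall (v1 v2 : nat) (z : k.-tuple nat),
     uniq [:: v1, v2 & z] ->
     (forall x, x \in [:: v1, v2 & z] -> x \notin tsvars t1 ++ tsvars t2) ->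
     is_independence_logic (inclusion_formula t1 t2 v1 v2 z) /\
     equivalent_over (tsvars t1 ++ tsvars t2)
       (FIncl t1 t2) (inclusion_formula t1 t2 v1 v2 z)) /\
  (exists p : formula S,
     [/\ is_independence_logic p,
         (forall x, x \in fvars p -> x \in tsvars t1 ++ tsvars t2) &
         equivalent_over (tsvars t1 ++ tsvars t2) (FIncl t1 t2) p]).
Proof.
split=> [v1 v2 z vs_uniq fresh|].
  split; first exact: is_independence_logic_inclusion_formula.
  exact: inclusion_formulaP.
(* [m] exceeds every variable of [t1] and [t2], so the consecutive variables from [m] on are fresh:
   [m] and [m.+1] serve as [v1] and [v2], the next [k] as [z]. *)
pose m := (\max_(x <- tsvars t1 ++ tsvars t2) x).+1.
exists (inclusion_formula t1 t2 m m.+1 (iota_tuple k m.+2)); split.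
- exact: is_independence_logic_inclusion_formula.
- exact: fvars_inclusion_formula.
apply: inclusion_formulaP; first exact: (iota_uniq m k.+2).
move=> x; rewrite (mem_iota m k.+2) => /andP [mx _].
by apply: contraL mx => xt; rewrite -leqNgt; apply: leq_bigmax_seq.
Qed.
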